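(* Let $t$ be a binary tree with $n$ nodes, partitioned by the Farzan–Munro algorithm with parameter $B$ into micro trees $\mu_1,\dots,\mu_m$ with split ranks $s_1,\dots,s_m$. Let $H$ be a Huffman code for the sequence of micro-tree shapes $\mu_1,\dots,\mu_m$ and $H'$ a Huffman code for the sequence of pairs $(\mu_1,s_1),\dots,(\mu_m,s_m)$. Then $$\sum_{i=1}^{m} |H'((\mu_i,s_i))| \le \sum_{i=1}^{m}|H(\mu_i)| + \mathrm{O}\!\left(\frac{n\log B}{B}\right).$$
   Context: A binary tree is a rooted tree where each node has a left and a right child slot, each possibly empty. $\mathrm{BP}_\mathrm{b}(t)=\epsilon$ if $t$ is empty and otherwise $\texttt{(}\cdot \mathrm{BP}_\mathrm{b}(t_l)\cdot \texttt{)}\cdot \mathrm{BP}_\mathrm{b}(t_r)$; node $v$ corresponds to the matching pair inserted when expanding the subtree rooted at $v$. The Farzan–Munro algorithm with parameter $B$ partitions the nodes of a binary tree into disjoint connected micro trees; it is known that there are $m=\mathrm{O}(n/B)$ micro trees and each has fewer than $2B$ nodes. Micro trees are regarded as binary-tree shapes. Chunks of $\mu$: the positions in $\mathrm{BP}_\mathrm{b}(t)$ of parentheses of nodes of $\mu$ form one or two maximal intervals; the left chunk is the left (or only) one. The split rank of $\mu$ is the number of closing parentheses in its left chunk plus one. A Huffman code for a finite sequence $x_1,\dots,x_m$ of symbols is a prefix-free binary code on the set of distinct symbols minimizing $\sum_i |H(x_i)|$ among all prefix-free codes. $\log$ is the natural logarithm. Throughout, the paper assumes $B$ is super-constant in $n$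 (i.e. $B\to\infty$ as $n\to\infty$), and $\mathrm{O}$ is asymptotic in $n$. *)

(* Defs.v *)
From HB Require Import structures.
From mathcomp Require Import all_boot.

Set Implicit Arguments.
Unset Strict Implicit.
Unset Printing Implicit Defensive.

Inductive bintree : Type := Empty | Node of bintree & bintree.

Fixpoint eq_bintree (t u : bintree) : bool :=
  match t, u with
  | Empty, Empty => true
  | Node tl tr, Node ul ur => eq_bintree tl ul && eq_bintree tr ur
  | _, _ => false
  end.

Lemma eq_bintreeP : Equality.axiom eq_bintree.
Proof.
elim=> [|tl IHl tr IHr] [|ul ur] /=; try by constructor.
by apply: (iffP andP) => [[/IHl -> /IHr ->]|[/IHl ? /IHr ?]].
Qed.

HB.instance Definition _ := hasDecEq.Build bintree eq_bintreeP.

Fixpoint num_nodes (t : bintree) : nat :=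
  if t is Node l r then (num_nodes l + num_nodes r).+1 else 0.

(* A node is named by the path leading to it from the root:
   [false] steps to the left child, [true] to the right child. *)
Definition node : Type := seq bool.

Fixpoint nodes (t : bintree) : seq node :=
  if t is Node l r then
    [::] :: [seq false :: v | v <- nodes l] ++ [seq true :: v | v <- nodes r]
  else [::].

(* [true] is the opening and [false] the closing parenthesis. *)
Definition paren : Type := bool.

(* BP_b(t), each parenthesis being paired with the node it corresponds to. *)
Fixpoint bpb_own (t : bintree) : seq (paren * node) :=
  if t is Node l r then
    (true, [::]) :: [seq (p.1, false :: p.2) | p <- bpb_own l]
    ++ (false, [::]) :: [seq (p.1, true :: p.2) | p <- bpb_own r]
  else [::].

Definition bpb (t : bintree) : seq paren := unzip1 (bpb_own t).

Lemma bpb_Node (l r : bintree) :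
  bpb (Node l r) = true :: bpb l ++ false :: bpb r.
Proof. by rewrite /bpb /unzip1 /= map_cat /= -!map_comp. Qed.

(* A connected set of nodes of a tree: its topmost node together with the
   binary tree it induces. *)
Record micro : Type := Micro { mroot : node; mshape : bintree }.

Definition mnodes (mu : micro) : seq node :=
  [seq mroot mu ++ v | v <- nodes (mshape mu)].

Definition mshift (b : bool) (mu : micro) : micro :=
  Micro (b :: mroot mu) (mshape mu).

(* Declares permanent a component [c] containing the root; [c] is [Empty]
   when the component of the root is already permanent. *)
Definition seal (c : bintree) (ms : seq micro) : seq micro :=
  if c is Empty then ms else Micro [::] c :: ms.

(* Bottom-up pass of the Farzan-Munro algorithm.  It returns the component of
   the root that is still growing ([Empty] if there is none) and the list of
   permanent components.  A node is heavy if its subtree has at least [B]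
   nodes.  A heavy node with two heavy children (a branching node) is a
   component on its own, and the components of its children become permanent.
   Any other node is merged with the growing components of its children, and
   the result becomes permanent once it has at least [B] nodes; in particular
   a light subtree is a single growing component. *)
Fixpoint fm_pass (B : nat) (t : bintree) : bintree * seq micro :=
  if t is Node l r then
    let: (cl, ml) := fm_pass B l in
    let: (cr, mr) := fm_pass B r in
    if (B <= num_nodes l) && (B <= num_nodes r) then
      (Empty, Micro [::] (Node Empty Empty)
              :: map (mshift false) (seal cl ml)
              ++ map (mshift true) (seal cr mr))
    else
      let c := Node cl cr in
      let ms := map (mshift false) ml ++ map (mshift true) mr in
      if B <= num_nodes c then (Empty, Micro [::] c :: ms) else (c, ms)
  else (Empty, [::]).

Definition farzan_munro (B : nat) (t : bintree) : seq micro :=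
  seal (fm_pass B t).1 (fm_pass B t).2.

(* The first maximal block of consecutive parentheses of BP_b(t) that belong
   to nodes of [mu]. *)
Definition left_chunk (t : bintree) (mu : micro) : seq (paren * node) :=
  let owned := fun p : paren * node => p.2 \in mnodes mu in
  let s := drop (find owned (bpb_own t)) (bpb_own t) in
  take (find (predC owned) s) s.

Definition split_rank (t : bintree) (mu : micro) : nat :=
  (count (fun p : paren * node => ~~ p.1) (left_chunk t mu)).+1.

Definition shapes (B : nat) (t : bintree) : seq bintree :=
  [seq mshape mu | mu <- farzan_munro B t].

Definition ranked_shapes (B : nat) (t : bintree) : seq (bintree * nat) :=
  [seq (mshape mu, split_rank t mu) | mu <- farzan_munro B t].

(* Only the values of the code [H] on the symbols occurring in [xs] matter.
   Distinctness of codewords is included, since a word is its own prefix; a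
   single symbol may receive the empty codeword. *)
Definition prefix_free (T : eqType) (xs : seq T) (H : T -> seq bool) : Prop :=
  {in xs &, forall x y, prefix (H x) (H y) -> x = y}.

Definition code_length (T : Type) (xs : seq T) (H : T -> seq bool) : nat :=
  \sum_(x <- xs) size (H x).

Definition huffman_code (T : eqType) (xs : seq T) (H : T -> seq bool) : Prop :=
  prefix_free xs H /\
  forall H', prefix_free xs H' -> code_length xs H <= code_length xs H'.

(* Main.v *)
(* Appending to the codeword of the shape a fixed-width binary encoding of the
   split rank gives a prefix-free code for the pairs, which the Huffman code
   [H'] can only improve.  The split rank exceeds by one the number of closing
   parentheses in a chunk, so it is at most 2B and O(log B) bits suffice; and
   there are at most 4n/B micro trees.  If n < B there is a single micro tree,
   whose Huffman codeword is empty. *)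
Require Import Defs.
From mathcomp Require Import all_boot all_order all_algebra.
From mathcomp Require Import all_classical all_reals all_analysis.
From mathcomp Require Import zify ring.

Set Implicit Arguments.
Unset Strict Implicit.
Unset Printing Implicit Defensive.

Import Order.TTheory GRing.Theory Num.Theory.
Local Open Scope classical_set_scope.
Local Open Scope ring_scope.

(** * Number and size of the micro trees *)

Lemma size_nodes (t : bintree) : size (nodes t) = num_nodes t.
Proof. by elim: t => //= l IHl r IHr; rewrite size_cat !size_map IHl IHr. Qed.

Lemma fm_pass_light (B : nat) (t : bintree) :
  (num_nodes t < B)%N -> fm_pass B t = (t, [::]).
Proof.
elim: t => //= l IHl r IHr tB.
rewrite IHl; last by lia.
rewrite IHr; last by lia.
rewrite leqNgt (leq_trans _ tB) /=; last by rewrite ltnS ltnW // ltnS leq_addr.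
by rewrite leqNgt tB.
Qed.

Lemma size_seal_le (c : bintree) (ms : seq micro) :
  (size (seal c ms) <= (size ms).+1)%N.
Proof. by case: c. Qed.

(* Amortization: each node carries 4 units of credit and each permanent
   component costs B.  A heavy subtree keeps 3B in reserve, enough to pay for
   the at most three components that a branching node makes permanent, and a
   growing component keeps one unit per node. *)
Lemma fm_pass_credit (B : nat) (t : bintree) : (B <= num_nodes t)%N ->
  (B * (size (fm_pass B t).2 + 3) + num_nodes (fm_pass B t).1
     <= 4 * num_nodes t)%N.
Proof.
elim: t => /= [|l IHl r IHr] tB; first by move: tB; rewrite leqn0 => /eqP ->.
have [lB|lB] := leqP B (num_nodes l).
- move: (IHl lB); case: (fm_pass B l) => cl ml /= {}IHl.
  have [rB|rB] := leqP B (num_nodes r).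
  + move: (IHr rB); case: (fm_pass B r) => cr mr /= {}IHr.
    rewrite size_cat !size_map.
    have := size_seal_le cl ml; have := size_seal_le cr mr.
    by nia.
  + rewrite (fm_pass_light rB) /=.
    by case: ifP => /= cB; rewrite cats0 size_map; nia.
- rewrite (fm_pass_light lB) /=.
  have [rB|rB] := leqP B (num_nodes r).
  + move: (IHr rB); case: (fm_pass B r) => cr mr /= {}IHr.
    by case: ifP => /= cB; rewrite size_map; nia.
  (* A lowest heavy node: its whole subtree becomes one component, and paying for it on top of the
     reserve takes 4B, which fixes the credit at 4 per node. *)
  + by rewrite (fm_pass_light rB) /= tB /=; nia.
Qed.

Lemma size_farzan_munro (B : nat) (t : bintree) : (B <= num_nodes t)%N ->
  (B * size (farzan_munro B t) <= 4 * num_nodes t)%N.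
Proof.
move=> tB; have := fm_pass_credit tB.
have := size_seal_le (fm_pass B t).1 (fm_pass B t).2.
by rewrite /farzan_munro; nia.
Qed.

Lemma size_farzan_munro_light (B : nat) (t : bintree) :
  (num_nodes t < B)%N -> (size (farzan_munro B t) <= 1)%N.
Proof. by move=> tB; rewrite /farzan_munro fm_pass_light //; case: t tB. Qed.

Lemma all_mshift (P : pred bintree) (b : bool) (ms : seq micro) :
  all (fun mu => P (mshape mu)) (map (mshift b) ms) =
  all (fun mu => P (mshape mu)) ms.
Proof. by rewrite all_map. Qed.

(** A growing component has at most B - 1 nodes, so joining two of them to their parent gives at
    most 2B - 1. *)
Lemma fm_pass_shape_lt (B : nat) (t : bintree) : (0 < B)%N ->
  (num_nodes (fm_pass B t).1 < B)%N &&
  all (fun mu => num_nodes (mshape mu) < B.*2)%N (fm_pass B t).2.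
Proof.
move=> B0; pose P u := (num_nodes u < B.*2)%N.
have sealP c ms : (num_nodes c < B)%N -> all (fun mu => P (mshape mu)) ms ->
    all (fun mu => P (mshape mu)) (seal c ms).
  by case: c => //= cl cr cB ->; rewrite /P /=; lia.
elim: t => /= [|l IHl r IHr]; first by rewrite B0.
case: (fm_pass B l) IHl => cl ml /= /andP[cl_lt ml_lt].
case: (fm_pass B r) IHr => cr mr /= /andP[cr_lt mr_lt].
case: ifP => _ /=.
  rewrite B0 /= all_cat !(all_mshift P) !sealP // !andbT.
  by lia.
case: ifP => cB /=; rewrite all_cat !(all_mshift P) /P ml_lt mr_lt !andbT.
  by rewrite B0 /=; lia.
by lia.
Qed.

Lemma farzan_munro_shape_lt (B : nat) (t : bintree) : (0 < B)%N ->
  all (fun mu => num_nodes (mshape mu) < B.*2)%N (farzan_munro B t).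
Proof.
move=> B0; have /andP[] := fm_pass_shape_lt t B0.
rewrite /farzan_munro; case: (fm_pass B t) => -[|cl cr] ms //= cB ->.
by lia.
Qed.

(** * Bound on the split rank *)

Lemma uniq_bpb_own (t : bintree) : uniq (bpb_own t).
Proof.
elim: t => //= l IHl r IHr.
have inj b : injective (fun p : paren * node => (p.1, b :: p.2)).
  by move=> [? ?] [? ?] /= [-> ->].
rewrite mem_cat inE cat_uniq /= !map_inj_uniq // IHl IHr /= !andbT.
apply/and3P; split; last by apply/mapP => -[].
  by apply/norP; split; apply/mapP => -[].
apply/norP; split; first by apply/mapP => -[].
by apply/hasPn => _ /mapP[p _ ->]; apply/mapP => -[].
Qed.

Lemma all_take_find (T : Type) (a : pred T) (s : seq T) :
  all a (take (find (predC a) s) s).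
Proof. by elim: s => //= x s IHs; case: ifP => //= /negbFE ->. Qed.

(** Every parenthesis of the chunk is owned by a node of [mu], and by [uniq_bpb_own] no node owns
    two closing ones. *)
Lemma split_rank_le (t : bintree) (mu : micro) :
  (split_rank t mu <= (num_nodes (mshape mu)).+1)%N.
Proof.
rewrite /split_rank ltnS -size_filter.
have -> : num_nodes (mshape mu) = size [seq (false, v) | v <- mnodes mu].
  by rewrite !size_map size_nodes.
apply: uniq_leq_size.
  by rewrite filter_uniq // take_uniq // drop_uniq // uniq_bpb_own.
move=> [b v]; rewrite mem_filter /= => /andP[/negbTE -> pv].
by apply: map_f; apply: (allP (all_take_find _ _) _ pv).
Qed.

(** * Appending a fixed-width word to a prefix-free code *)

(** An enumeration of the [k]-bit words replaces binary expansion: injectivity is then its lack of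
    duplicates. From [2 ^ k] on, the value is the default empty word. *)
Definition fixed_width (k s : nat) : seq bool :=
  nth [::] (map val (enum {: k.-tuple bool})) s.

Lemma size_enum_bits (k : nat) :
  size (map val (enum {: k.-tuple bool})) = (2 ^ k)%N.
Proof. by rewrite size_map -cardE card_tuple card_bool. Qed.

Lemma size_fixed_width (k s : nat) :
  (s < 2 ^ k)%N -> size (fixed_width k s) = k.
Proof.
rewrite -size_enum_bits => /(mem_nth [::]) /mapP[w _ ws].
by rewrite /fixed_width ws size_tuple.
Qed.

Lemma fixed_width_inj (k s s' : nat) : (s < 2 ^ k)%N -> (s' < 2 ^ k)%N ->
  fixed_width k s = fixed_width k s' -> s = s'.
Proof.
rewrite -size_enum_bits => sk s'k /eqP.
rewrite nth_uniq //; first by move=> /eqP.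
by rewrite (map_inj_uniq val_inj) enum_uniq.
Qed.

Lemma prefix_size_eq (T : eqType) (u v : seq T) :
  prefix u v -> size u = size v -> u = v.
Proof.
by rewrite prefixE => /eqP + uv; rewrite uv take_size.
Qed.

(** Both [u] and [u'] are prefixes of the same word [u' ++ v']. *)
Lemma prefix_cat_comparable (T : eqType) (u v u' v' : seq T) :
  prefix (u ++ v) (u' ++ v') -> prefix u u' || prefix u' u.
Proof.
elim: u u' => [|x u IHu] [|x' u'] //=.
by case/andP => /eqP -> /IHu; rewrite eqxx.
Qed.

(** Comparability of the [H]-parts forces equal first components; the remaining words have equal
    length, so a prefix is an equality. *)
Lemma prefix_free_fixed_width (T : eqType) (xs : seq (T * nat))
    (H : T -> seq bool) (k : nat) :
  prefix_free (unzip1 xs) H -> all (fun x => x.2 < 2 ^ k)%N xs ->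
  prefix_free xs (fun x => H x.1 ++ fixed_width k x.2).
Proof.
move=> pfH /allP xsk [x s] [y s'] xs_in ys_in /= pf.
have xin : x \in unzip1 xs by apply: (map_f fst xs_in).
have yin : y \in unzip1 xs by apply: (map_f fst ys_in).
have xy : x = y.
  by case/orP: (prefix_cat_comparable pf) => [/pfH|/pfH/esym]; apply.
move: pf; rewrite xy prefix_catr // eqxx /= => pf.
have /= sk := xsk _ xs_in; have /= s'k := xsk _ ys_in.
by rewrite (fixed_width_inj sk s'k) //; apply: prefix_size_eq pf _;
  rewrite !size_fixed_width.
Qed.

(** With at most one symbol, the constant empty codeword is a prefix-free competitor of length 0. *)
Lemma huffman_code_size_le1 (T : eqType) (xs : seq T) (H : T -> seq bool) :
  (size xs <= 1)%N -> huffman_code xs H -> code_length xs H = 0%N.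
Proof.
move=> xs1 [_ /(_ (fun=> [::]))].
rewrite {2}/code_length big1 // leqn0 => /(_ _)/eqP -> //.
case: xs xs1 => [|z [|? ?]] //= _ x y.
by rewrite !inE => /eqP -> /eqP ->.
Qed.

Lemma ranked_code_length_le (B k : nat) (t : bintree)
    (H : bintree -> seq bool) (H' : bintree * nat -> seq bool) :
  (0 < B)%N -> (B.*2 < 2 ^ k)%N ->
  huffman_code (shapes B t) H -> huffman_code (ranked_shapes B t) H' ->
  (code_length (ranked_shapes B t) H'
     <= code_length (shapes B t) H + size (farzan_munro B t) * k)%N.
Proof.
move=> B0 Bk [pfH _] [_ optH'].
have rank_lt : all (fun x => x.2 < 2 ^ k)%N (ranked_shapes B t).
  rewrite all_map; apply: sub_all (farzan_munro_shape_lt t B0) => mu /= mu_lt.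
  (* At most 2B - 1 nodes give a split rank of at most 2B, which is below [2 ^ k]. *)
  by have := split_rank_le t mu; lia.
have unzip_ranked : shapes B t = unzip1 (ranked_shapes B t).
  by rewrite /unzip1 -map_comp.
rewrite unzip_ranked in pfH *.
apply: leq_trans (optH' _ (prefix_free_fixed_width pfH rank_lt)) _.
have -> : size (farzan_munro B t) = size (ranked_shapes B t).
  by rewrite size_map.
move: (ranked_shapes B t) rank_lt => xs rank_lt.
rewrite /code_length big_map -[size xs]sum1_size big_distrl -big_split /=.
rewrite big_seq [leqRHS]big_seq; apply: leq_sum => x /(allP rank_lt) x_lt.
by rewrite size_cat size_fixed_width // mul1n.
Qed.

(** * Choice of the width and the asymptotic bound *)

(** The least such [k] has [2 ^ k <= 4 * B <= B ^ 3]; the cube makes [k] at most 3 times the binary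
    logarithm of [B], with no additive constant. *)
Lemma exp2_width (B : nat) : (2 <= B)%N ->
  exists2 k, (B.*2 < 2 ^ k)%N & (2 ^ k <= B ^ 3)%N.
Proof.
move=> B2; exists (trunc_log 2 B.*2).+1; first exact: trunc_log_ltn.
have := @trunc_logP 2 B.*2 isT; rewrite double_gt0 => /(_ (ltnW B2)).
rewrite expnS => le2B; apply: (@leq_trans (2 * B.*2)); first by lia.
have BB : (4 <= B * B)%N by rewrite -[4%N]/(2 * 2)%N leq_mul.
by rewrite !expnS expn0 muln1; nia.
Qed.

Theorem theorem20 (R : realType) (B : nat -> nat)
    (hB : B n @[n --> \oo] --> \oo) :
  exists (C : R) (n0 : nat), forall (n : nat) (t : bintree)
      (H : bintree -> seq bool) (H' : bintree * nat -> seq bool),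
    (n0 <= n)%N -> num_nodes t = n ->
    huffman_code (shapes (B n) t) H ->
    huffman_code (ranked_shapes (B n) t) H' ->
    (code_length (ranked_shapes (B n) t) H')%:R <=
    (code_length (shapes (B n) t) H)%:R +
      C * (n%:R * ln (B n)%:R / (B n)%:R) :> R.
Proof.
have [N _ BN] := hB _ (nbhs_infty_ge 2).
(* 12 is 4 from the count 4n/B of micro trees times 3 from the width; [ln 2] converts binary to
   natural logarithms. *)
exists (12 / ln 2), N => n t H H' /BN /= B2 nt hufH hufH'.
have B0 : (0 < B n)%N by exact: ltnW.
have BR0 : 0 < (B n)%:R :> R by rewrite ltr0n.
have ln2_gt0 : 0 < ln 2 :> R by rewrite ln_gt0 // ltr1n.
have lnB_ge0 : 0 <= ln (B n)%:R :> R by rewrite ln_ge0 // ler1n.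
(* If [n < B n], then 4n/B may be below 1 and fail to bound the count, but the left-hand side is
   0. *)
have [nB|Bn] := ltnP n (B n).
  rewrite (huffman_code_size_le1 _ hufH'); last first.
    by rewrite size_map size_farzan_munro_light // nt.
  by rewrite addr_ge0 // !mulr_ge0 // ?invr_ge0 // ltW.
have [k Bk kB] := exp2_width B2.
have := ranked_code_length_le B0 Bk hufH hufH'.
rewrite -(ler_nat R) natrD natrM => /le_trans; apply; rewrite lerD2l.
have k_le : k%:R * ln 2 <= 3 * ln (B n)%:R :> R.
  rewrite !mulr_natl -!lnXn ?ltr0n // -!natrX ler_ln ?posrE ?ltr0n ?expn_gt0 ?B0 //.
  by rewrite ler_nat.
have := @size_farzan_munro (B n) t; rewrite nt => /(_ Bn).
rewrite -(ler_nat R) !natrM => m_le.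
set m := size _ in m_le *.
have -> : 12 / ln 2 * (n%:R * ln (B n)%:R / (B n)%:R) =
    (4 * n%:R / (B n)%:R) * (3 * ln (B n)%:R / ln 2) :> R.
  by field; rewrite !gt_eqF.
by apply: ler_pM; rewrite ?ler0n // ler_pdivlMr // mulrC.
Qed.
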